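(* Let $n\ge1$ and let $h\in\Lambda^n(J_n)$ be a faithful polynomial. Then $h=g(\Gamma,\alpha)$ is the torus polynomial of an oriented torus graph $(\Gamma,\alpha,\sigma)$ if and only if $d(h^* )=0$.
   Context: $T^n=(S^1)^n$; $\mathrm{Hom}(T^n,S^1)\cong\mathbb{Z}^n$ and $\mathrm{Hom}(S^1,T^n)\cong\mathbb{Z}^n$ are dual via $\langle\rho,\xi\rangle=\xi\circ\rho\in\mathrm{Hom}(S^1,S^1)\cong\mathbb{Z}$. Torus graphs. Let $\Gamma$ be a finite $n$-valent graph (multiple edges allowed, possibly empty or disconnected), with vertex set $\mathcal{V}(\Gamma)$ and set of oriented edges $\mathcal{E}(\Gamma)$ (each edge appears twice, once per orientation). For $e\in\mathcal{E}(\Gamma)$ let $i(e),t(e)$ be its initial and terminal vertices and $\bar e$ the same edge with opposite orientation; $\mathcal{E}(\Gamma)_p=\{e: i(e)=p\}$. A torus axial function is a map $\alpha\colon\mathcal{E}(\Gamma)\to\mathrm{Hom}(T^n,S^1)\cong\mathbb{Z}^n$ such that (1) $\alpha(\bar e)=\pm\alpha(e)$; (2) for each vertex $p$, the elements $\alpha(e)$, $e\in\mathcal{E}(\Gamma)_p$, form a basis of $\mathbb{Z}^n$; (3) $\alpha(\mathcal{E}(\Gamma)_{t(e)})\equiv\alpha(\mathcal{E}(\Gamma)_{i(e)})\bmod\alpha(e)$ (as sets) for every $e$. A torus graph is a pair $(\Gamma,\alpha)$. An orientation is a map $\sigma\colon\mathcal{V}(\Gamma)\to\{\pm1\}$ with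 $\sigma(i(e))\alpha(e)=-\sigma(i(\bar e))\alpha(\bar e)$ for every $e\in\mathcal{E}(\Gamma)$. Exterior polynomials. $J_n=\mathrm{Hom}(T^n,S^1)\setminus\{0\}$, $J_n^*=\mathrm{Hom}(S^1,T^n)\setminus\{0\}$. For a set $S$, $\Lambda(S)=\bigoplus_k\Lambda^k(S)$ is the free exterior $\mathbb{Z}$-algebra on the set $S$ (elements of $S$ are independent symbols, $X\wedge X=0$, $X\wedge Y=-Y\wedge X$). A polynomial $h\in\Lambda^n(J_n)$ is faithful if the indeterminates of each of its monomials form a basis of $\mathbb{Z}^n$. Its dual $h^*\in\Lambda^n(J_n^* )$ is obtained by replacing each monomial $s_1\wedge\dots\wedge s_n$ by $s_1^*\wedge\dots\wedge s_n^*$, with $(s_i^* )$ the dual basis (extended linearly). The linear boundary $d=d_k\colon\Lambda^k(J_n^* )\to\Lambda^{k-1}(J_n^* )$ is $d_k(s_1\wedge\dots\wedge s_k)=\sum_{i=1}^k(-1)^{i+1}s_1\wedge\dots\wedge\widehat{s_i}\wedge\dots\wedge s_k$ for $k>1$, $d_1(s_1)=1$, $d_0(1)=0$. Torus polynomial. For an oriented torus graph $(\Gamma,\alpha,\sigma)$ and vertex $p$ put $\mu_p=\alpha(e_1)\wedge\dots\wedge\alpha(e_n)\in\Lambda^n(J_n)$, where $\mathcal{E}(\Gamma)_p=\{e_1,\dots,e_n\}$ is ordered so that $\det[\alpha(e_1)\cdots\alpha(e_n)]=\sigma(p)$; for $n=1$, $\mu_p=\alpha(e)$ if $\det[\alpha(e)]=\sigma(p)$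 and $\mu_p=-\alpha(e)$ otherwise. The torus polynomial is $g(\Gamma,\alpha)=\sum_{p\in\mathcal{V}(\Gamma)}\mu_p$. *)

(* Defs.v *)
From HB Require Import structures.
From mathcomp Require Import all_boot all_order all_algebra fingroup perm.
From mathcomp Require Import generic_quotient ring_quotient.
From mathcomp Require Import finmap monalg boolp.
From mathcomp Require Import zify.

Set Implicit Arguments.
Unset Strict Implicit.
Unset Printing Implicit Defensive.

Import GRing.Theory.
Local Open Scope ring_scope.
Local Open Scope quotient_scope.

(* The degree k part of the free exterior Z-algebra on a set S: the free
   abelian group on the words s_1 ... s_k with letters in S (the degree k part
   of the free associative algebra), modulo the degree k part of the two-sided
   ideal generated by the elements XX and XY + YX. *)

Section Exterior.
Variables (k : nat) (S : choiceType).

Local Notation word := {ffun 'I_k -> S}.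

Definition swap (i j : 'I_k) (s : word) : word := [ffun l => s (tperm i j l)].

Inductive ext_rel : {malg int[word]} -> Prop :=
| ext_rel0 : ext_rel 0
| ext_relB x y of ext_rel x & ext_rel y : ext_rel (x - y)
| ext_rel_square (s : word) (i j : 'I_k) of
    (j = i.+1 :> nat) & s i = s j : ext_rel << s >>
| ext_rel_swap (s : word) (i j : 'I_k) of
    (j = i.+1 :> nat) : ext_rel (<< s >> + << swap i j s >>).

Definition ext_ideal : {pred {malg int[word]}} := fun x => `[< ext_rel x >].

Fact ext_ideal_zmod_closed : zmod_closed ext_ideal.
Proof.
split=> [|x y /asboolP rx /asboolP ry]; first exact/asboolP/ext_rel0.
exact/asboolP/ext_relB.
Qed.

HB.instance Definition _ :=
  GRing.isZmodClosed.Build {malg int[word]} ext_ideal ext_ideal_zmod_closed.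

Definition ext := Quotient.quot ext_ideal.
HB.instance Definition _ := GRing.Zmodule.on ext.
HB.instance Definition _ := EqQuotient.on ext.

Definition wedge (s : word) : ext := \pi_ext << s >>.

(* The Z-linear map on ext sending [wedge s] to [f s]; it is independent of the
   choice of representative as soon as f is alternating, see [ext_lift_wedge]
   and [ext_liftB]. *)
Definition free_lift (V : zmodType) (f : word -> V) (x : {malg int[word]}) : V :=
  \sum_(s <- msupp x) f s *~ x@_s.

Definition ext_lift (V : zmodType) (f : word -> V) (x : ext) : V :=
  free_lift f (repr x).

Definition alternating (V : zmodType) (f : word -> V) : Prop :=
  (forall (s : word) (i j : 'I_k), j = i.+1 :> nat -> s i = s j -> f s = 0) /\
  (forall (s : word) (i j : 'I_k), j = i.+1 :> nat -> f (swap i j s) = - f s).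

Section Lift.
Variables (V : zmodType) (f : word -> V).

Lemma free_liftEw x (D : {fset word}) : (msupp x `<=` D)%fset ->
  free_lift f x = \sum_(s <- D) f s *~ x@_s.
Proof.
move=> sxD; rewrite /free_lift (big_fset_incl _ sxD) // => s _.
by rewrite -mcoeff_eq0 => /eqP->.
Qed.

Lemma free_liftB x y : free_lift f (x - y) = free_lift f x - free_lift f y.
Proof.
pose D := (msupp x `|` msupp y)%fset.
rewrite (@free_liftEw x D) ?fsubsetUl // (@free_liftEw y D) ?fsubsetUr //.
rewrite (@free_liftEw (x - y) D) ?msuppB_le // -sumrB.
by apply: eq_bigr => s _; rewrite mcoeffB mulrzBr.
Qed.

Lemma free_liftD x y : free_lift f (x + y) = free_lift f x + free_lift f y.
Proof.
have N z : free_lift f (- z) = - free_lift f z.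
  by rewrite -(sub0r z) free_liftB {1}/free_lift msupp0 big_seq_fset0 sub0r.
by rewrite -{1}(opprK y) free_liftB N opprK.
Qed.

Lemma free_liftU s : free_lift f << s >> = f s.
Proof.
by rewrite (free_liftEw (msuppU_le (x := 1))) big_seq_fset1 mcoeffUU mulr1z.
Qed.

Hypothesis alt_f : alternating f.

Lemma free_lift_ext_rel x : ext_rel x -> free_lift f x = 0.
Proof.
case: alt_f => sq sw; elim=> [|y z _ fy0 _ fz0|s i j ij sij|s i j ij].
- by rewrite /free_lift msupp0 big_seq_fset0.
- by rewrite free_liftB fy0 fz0 subr0.
- by rewrite free_liftU (sq _ _ _ ij sij).
- by rewrite free_liftD !free_liftU (sw _ _ _ ij) subrr.
Qed.

Lemma ext_lift_pi x : ext_lift f (\pi_ext x) = free_lift f x.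
Proof.
apply/eqP; rewrite -subr_eq0 -free_liftB; apply/eqP/free_lift_ext_rel/asboolP.
have : repr (\pi_ext x) - x \in ext_ideal.
  by rewrite Quotient.idealrBE reprK.
by [].
Qed.

Lemma ext_liftB x y : ext_lift f (x - y) = ext_lift f x - ext_lift f y.
Proof.
elim/quotW: x => x; elim/quotW: y => y.
have -> : \pi_ext x - \pi_ext y = \pi_ext (x - y) by rewrite !piE.
by rewrite !ext_lift_pi free_liftB.
Qed.

Lemma ext_lift_wedge s : ext_lift f (wedge s) = f s.
Proof. by rewrite ext_lift_pi free_liftU. Qed.

End Lift.

Lemma wedge_alternating : alternating wedge.
Proof.
split=> [s i j ij sij|s i j ij].
  have /eqP : << s >> == 0 %[mod ext].
    by rewrite -Quotient.idealrBE subr0; apply/asboolP/(ext_rel_square ij).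
  by rewrite /wedge => ->; rewrite !piE.
apply/eqP; rewrite -addr_eq0 addrC /wedge.
have : << s >> + << swap i j s >> == 0 %[mod ext].
  by rewrite -Quotient.idealrBE subr0; apply/asboolP/ext_rel_swap.
by rewrite !piE.
Qed.

(* The coefficient of t_1 ^ ... ^ t_k in an element of ext: on a monomial
   s_1 ^ ... ^ s_k it is the determinant of the matrix with entries
   [s_i = t_j], which is the sign of the permutation taking t to s if the
   letters of t are distinct and s is a permutation of t, and 0 otherwise. *)
Definition coef_word (t s : word) : int :=
  \det (\matrix_(i < k, j < k) (s i == t j)%:R).

Definition coef (t : word) : ext -> int := ext_lift (coef_word t).

Lemma coef_alternating t : alternating (coef_word t).
Proof.
split=> [s i j ij sij|s i j ij].
  have nij : i != j by rewrite -val_eqE /= ij neq_ltn ltnSn.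
  by apply: (determinant_alternate nij) => l; rewrite !mxE sij.
rewrite /coef_word; set A := \matrix_(_, _) (s _ == _)%:R.
have -> : (\matrix_(i0, j0) (swap i j s i0 == t j0)%:R) = row_perm (tperm i j) A.
  by apply/matrixP=> a b; rewrite !mxE ffunE.
rewrite row_permE det_mulmx det_perm odd_tperm.
by rewrite -val_eqE /= ij neq_ltn ltnSn expr1 mulN1r.
Qed.

End Exterior.

Arguments wedge {k S} s.
Arguments coef {k S} t x.


Section Boundary.
Variables (k : nat) (S : choiceType).

Definition delete (i : 'I_k) (s : {ffun 'I_k -> S}) : {ffun 'I_k.-1 -> S} :=
  [ffun j => s (lift i j)].

(* Indices start at 0, whence the sign (-1)^i.  For k = 1 the only term is the
   empty monomial 1, and for k = 0 the sum is empty. *)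
Definition boundary_word (s : {ffun 'I_k -> S}) : ext k.-1 S :=
  \sum_(i < k) wedge (delete i s) *~ (-1) ^+ i.

Definition boundary : ext k S -> ext k.-1 S := ext_lift boundary_word.

End Boundary.

Lemma boundary_alternating k (S : choiceType) :
  alternating (@boundary_word k S).
Proof.
case: k => [|k]; first by split=> s [].
have adj (i j : 'I_k.+1) : j = i.+1 :> nat -> j != i.
  by move=> ij; rewrite -val_eqE /= ij neq_ltn ltnSn orbT.
(* deleting a letter other than i and j keeps i and j adjacent *)
have del (i j l : 'I_k.+1) : j = i.+1 :> nat -> (l != i) && (l != j) ->
    exists i' j' : 'I_k,
      [/\ j' = i'.+1 :> nat, lift l i' = i & lift l j' = j].
  move=> ij /andP[li lj]; have [i' ei _] := unlift_some li.
  have [j' ej _] := unlift_some lj; exists i', j'; split=> //.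
  move: ij li lj; rewrite ei ej -!val_eqE /= /bump => ij _ _.
  by lia.
have two (i j : 'I_k.+1) (F : 'I_k.+1 -> ext k S) : j = i.+1 :> nat ->
    \sum_l F l *~ (-1) ^+ l =
    (F i - F j) *~ (-1) ^+ i +
    \sum_(l | (l != i) && (l != j)) F l *~ (-1) ^+ l.
  move=> ij; rewrite (bigD1 i) //= (bigD1 j) ?adj //= addrA; congr (_ + _).
  by rewrite ij exprS mulN1r mulrNz mulrzBl.
have delE (i j : 'I_k.+1) (s : {ffun 'I_k.+1 -> S}) : j = i.+1 :> nat ->
    s i = s j -> delete i s = delete j s.
  move=> ij sij; apply/ffunP=> l; rewrite !ffunE; move: (l : 'I_k) => {}l.
  have [El|nl] := eqVneq (l : nat) i.
    have -> : lift i l = j by apply/val_inj; rewrite /= /bump; lia.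
    by have -> : lift j l = i by apply/val_inj; rewrite /= /bump; lia.
  by congr (s _); apply/val_inj; rewrite /= /bump; lia.
have same (i j : 'I_k.+1) (s : {ffun 'I_k.+1 -> S}) : j = i.+1 :> nat ->
    delete i (swap i j s) = delete j s.
  move=> ij; apply/ffunP=> l; rewrite !ffunE; congr (s _).
  move: (l : 'I_k) => {}l; have [El|nl] := eqVneq (l : nat) i.
    have -> : lift i l = j by apply/val_inj; rewrite /= /bump; lia.
    by rewrite tpermR; apply/val_inj; rewrite /= /bump; lia.
  rewrite tpermD; first by apply/val_inj; rewrite /= /bump; lia.
    by rewrite -val_eqE /= /bump; lia.
  by rewrite -val_eqE /= /bump; lia.
have swapK (i j : 'I_k.+1) (s : {ffun 'I_k.+1 -> S}) : swap i j (swap i j s) = s.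
  by apply/ffunP=> l; rewrite !ffunE tpermK.
have swapC (i j : 'I_k.+1) (s : {ffun 'I_k.+1 -> S}) : swap i j s = swap j i s.
  by apply/ffunP=> l; rewrite !ffunE tpermC.
have [sq sw] := @wedge_alternating k S.
split=> s i j ij.
  move=> sij; rewrite /boundary_word (two i j) // (delE i j) // subrr mul0rz add0r.
  rewrite big1 // => l /(del _ _ _ ij)[i' [j' [ij' ei ej]]].
  by rewrite (sq _ _ _ ij') ?mul0rz // !ffunE ei ej.
rewrite /boundary_word !(two i j) // opprD; congr (_ + _).
  rewrite -mulNrz opprB same //; congr ((_ - wedge _) *~ _).
  by rewrite -{2}(swapK i j s) same.
rewrite -sumrN; apply: eq_bigr => l /(del _ _ _ ij)[i' [j' [ij' ei ej]]].
rewrite -mulNrz -(sw _ _ _ ij'); congr (wedge _ *~ _).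
apply/ffunP=> m; rewrite !ffunE -ei -ej; congr (s _).
case: tpermP => [/lift_inj->|/lift_inj->|/eqP ni /eqP nj].
- by rewrite tpermL.
- by rewrite tpermR.
- by rewrite tpermD // eq_sym; [move: ni|move: nj]; rewrite (inj_eq lift_inj).
Qed.

(* Hom(T^n, S^1) is identified with row vectors and Hom(S^1, T^n) with column
   vectors, the pairing <rho, xi> being the product xi *m rho. *)

Definition J (n : nat) := {v : 'rV[int]_n | v != 0}.
HB.instance Definition _ n := Choice.on (J n).

Definition Jdual (n : nat) := {v : 'cV[int]_n | v != 0}.
HB.instance Definition _ n := Choice.on (Jdual n).

Definition pairing n (rho : 'cV[int]_n) (xi : 'rV[int]_n) : int :=
  (xi *m rho) 0 0.

Definition is_Zbasis n (I : finType) (v : I -> 'rV[int]_n) : Prop :=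
  forall x : 'rV[int]_n, exists! c : {ffun I -> int}, x = \sum_i c i *: v i.

Lemma Zbasis_neq0 n (I : finType) (v : I -> 'rV[int]_n) i :
  is_Zbasis v -> v i != 0.
Proof.
move=> /(_ 0)[c [_ uc]]; apply/eqP => vi0.
have c0 : c = [ffun=> 0].
  by apply: uc; rewrite big1 // => j _; rewrite ffunE scale0r.
have c1 : c = [ffun j => (j == i)%:R].
  apply: uc; rewrite big1 // => j _; rewrite ffunE.
  by case: eqVneq => [->|_]; rewrite ?scale0r // vi0 scaler0.
by have /ffunP/(_ i) := etrans (esym c0) c1; rewrite !ffunE eqxx.
Qed.

Lemma Zbasis_unitmx n (v : 'I_n -> 'rV[int]_n) :
  is_Zbasis v <-> \matrix_i v i \in unitmx.
Proof.
split=> [bv|uv x].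
  have /fin_all_exists[C CE] (i : 'I_n) : exists c : {ffun 'I_n -> int},
      delta_mx 0 i = \sum_j c j *: v j.
    by have [c [cE _]] := bv (delta_mx 0 i); exists c.
  suff /mulmx1_unit[] : (\matrix_(i, j) C i j) *m (\matrix_i v i) = 1%:M by [].
  apply/row_matrixP=> i; rewrite row_mul row1 CE mulmx_sum_row.
  by apply: eq_bigr => j _; rewrite rowK !mxE.
exists [ffun j => (x *m invmx (\matrix_i v i)) 0 j]; split.
  rewrite -[LHS](mulmxKV uv) [LHS]mulmx_sum_row.
  by apply: eq_bigr => j _; rewrite rowK ffunE.
move=> c xE; apply/ffunP=> j; rewrite ffunE xE.
have -> : \sum_i c i *: v i = (\row_i c i) *m (\matrix_i v i).
  by rewrite mulmx_sum_row; apply: eq_bigr => i _; rewrite rowK mxE.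
by rewrite mulmxK // mxE.
Qed.

Section Dual.
Variable n : nat.
Implicit Type s : {ffun 'I_n -> J n}.

Definition basis_word s : Prop := is_Zbasis (fun i => val (s i)).

Definition word_mx s : 'M[int]_n := \matrix_i val (s i).

Lemma dual_vec_neq0 s (bs : basis_word s) j : col j (invmx (word_mx s)) != 0.
Proof.
have /Zbasis_unitmx us := bs.
apply/eqP => /colP c0; have /matrixP/(_ j j) := mulmxV us.
rewrite mxE big1 ?mxE ?eqxx // => l _.
by have := c0 l; rewrite !mxE => ->; rewrite mulr0.
Qed.

(* The columns of the inverse matrix form the dual basis, see
   [pairing_dual_word]. *)
Definition dual_word s (bs : basis_word s) : {ffun 'I_n -> Jdual n} :=
  [ffun j => exist _ (col j (invmx (word_mx s))) (dual_vec_neq0 bs j)].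

Lemma pairing_dual_word s (bs : basis_word s) i j :
  pairing (val (dual_word bs j)) (val (s i)) = (i == j)%:R.
Proof.
have /Zbasis_unitmx us := bs.
have /matrixP/(_ i j) := mulmxV us; rewrite [in X in _ = X -> _]mxE => <-.
by rewrite ffunE /pairing !mxE; apply: eq_bigr => l _; rewrite !mxE.
Qed.

Lemma dual_word_unique s (bs : basis_word s) (t : {ffun 'I_n -> Jdual n}) :
    (forall i j, pairing (val (t j)) (val (s i)) = (i == j)%:R) ->
  dual_word bs = t.
Proof.
have /Zbasis_unitmx us := bs.
move=> tE; apply/ffunP=> j; apply/val_inj; rewrite ffunE /=.
pose T := \matrix_(a < n, b < n) val (t b) a 0.
have ST : word_mx s *m T = 1%:M.
  apply/matrixP=> a b; rewrite [RHS]mxE -tE /pairing !mxE.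
  by apply: eq_bigr => l _; rewrite !mxE.
have -> : invmx (word_mx s) = T by rewrite -[T](mulKmx us) ST mulmx1.
by apply/colP=> a; rewrite !mxE.
Qed.

(* Duality concerns faithful polynomials only; monomials whose letters do not
   form a basis are sent to 0. *)
Definition dual_monomial s : ext n (Jdual n) :=
  match pselect (basis_word s) with
  | left bs => wedge (dual_word bs)
  | right _ => 0
  end.

Definition dual : ext n (J n) -> ext n (Jdual n) := ext_lift dual_monomial.

Definition faithful (h : ext n (J n)) : Prop :=
  forall s, coef s h != 0 -> basis_word s.

Lemma dual_alternating : alternating dual_monomial.
Proof.
have [_ sw] := @wedge_alternating n (Jdual n).
split=> s i j ij.
  move=> sij; rewrite /dual_monomial; case: pselect => // bs.
  have := pairing_dual_word bs i j; rewrite sij pairing_dual_word eqxx.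
  by rewrite -val_eqE /= ij ltn_eqF.
have mxE' : word_mx (swap i j s) = row_perm (tperm i j) (word_mx s).
  by apply/matrixP=> a b; rewrite !mxE ffunE.
have bE : basis_word (swap i j s) <-> basis_word s.
  rewrite /basis_word !Zbasis_unitmx -/(word_mx _) -/(word_mx s) mxE'.
  by rewrite row_permE unitmx_mul unitmx_perm.
rewrite /dual_monomial; case: pselect => [b1|nb1]; case: pselect => [b2|nb2].
- rewrite -(sw _ _ _ ij); congr wedge; apply: dual_word_unique => a b.
  by rewrite [swap _ _ s _]ffunE [swap _ _ _ _]ffunE pairing_dual_word (inj_eq perm_inj).
- by case: nb2; apply/bE.
- by case: nb1; apply/bE.
- by rewrite oppr0.
Qed.

End Dual.

(* Loops need not be excluded: they are incompatible with the axial function,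
   since e and its reverse would then be distinct members of a basis which are
   equal up to sign. *)
Record multigraph := Multigraph {
  vertex : finType;
  edge : finType;
  init : edge -> vertex;
  reverse : edge -> edge;
  reverseK : involutive reverse;
  reverse_neq : forall e, reverse e != e
}.

Section Graph.
Variable G : multigraph.

Definition term (e : edge G) : vertex G := init (reverse e).

Definition edges_at (p : vertex G) : {set edge G} := [set e | init e == p].

Definition regular (n : nat) : Prop := forall p, #|edges_at p| = n.

Record axial_axioms n (alpha : edge G -> 'rV[int]_n) : Prop := AxialAxioms {
  axial_reverse : forall e, alpha (reverse e) = alpha e \/
                            alpha (reverse e) = - alpha e;
  axial_basis : forall p,
    is_Zbasis (fun e : {e : edge G | e \in edges_at p} => alpha (val e));
  axial_congr : forall e,
    (forall e1, e1 \in edges_at (term e) ->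
       exists2 e2, e2 \in edges_at (init e) &
                   exists k : int, alpha e1 - alpha e2 = k *: alpha e) /\
    (forall e2, e2 \in edges_at (init e) ->
       exists2 e1, e1 \in edges_at (term e) &
                   exists k : int, alpha e1 - alpha e2 = k *: alpha e)
}.

End Graph.

Record torus_graph (n : nat) := TorusGraph {
  tgraph :> multigraph;
  tgraph_regular : regular tgraph n;
  axial : edge tgraph -> 'rV[int]_n;
  axialP : axial_axioms axial
}.

Section TorusPolynomial.
Variables (n : nat) (G : torus_graph n).

Lemma axial_neq0 (e : edge G) : axial e != 0.
Proof.
have ei : e \in edges_at (init e) by rewrite inE.
exact: (Zbasis_neq0 (Sub e ei) (axial_basis (axialP G) (init e))).
Qed.

Definition axialJ (e : edge G) : J n := exist _ (axial e) (axial_neq0 e).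

Definition is_orientation (sigma : vertex G -> int) : Prop :=
  (forall p, sigma p = 1 \/ sigma p = -1) /\
  (forall e : edge G, sigma (init e) *: axial e =
                      - (sigma (init (reverse e)) *: axial (reverse e))).

Variable sigma : vertex G -> int.

Definition enumerates (p : vertex G) (es : {ffun 'I_n -> edge G}) : bool :=
  perm_eq (codom es) (enum (edges_at p)).

Definition axial_det (es : {ffun 'I_n -> edge G}) : int :=
  \det (\matrix_(i < n, j < n) axial (es j) 0 i).

Definition axial_wedge (es : {ffun 'I_n -> edge G}) : ext n (J n) :=
  wedge [ffun i => axialJ (es i)].

(* For n > 1 the edges at p can always be ordered so that the determinant is
   sigma p (exchange two of them if needed), and by antisymmetry the result does
   not depend on the order.  The second case occurs for n = 1 only. *)
Definition vertex_monomial (p : vertex G) : ext n (J n) :=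
  if [pick es | enumerates p es && (axial_det es == sigma p)] is Some es
  then axial_wedge es
  else if [pick es | enumerates p es] is Some es then - axial_wedge es
  else 0.

Definition torus_polynomial : ext n (J n) := \sum_p vertex_monomial p.

End TorusPolynomial.

(* Main.v *)
(* Each vertex p of a torus graph contributes to d(h^* ) the n faces of its dual
   basis, one for each edge e at p (delete the vector dual to alpha(e)).  If e
   joins p to q, then the bases at p and q agree modulo alpha(e) if and only if
   the corresponding faces of the dual bases agree up to order, and the relation
   between sigma(p) and sigma(q) says that these two faces occur with opposite
   signs; hence d(h^* ) = 0.  Conversely, write a faithful h as a signed sum of
   basis monomials.  If d(h^* ) = 0, the signed faces cancel in pairs, and the
   graph whose edges are the pairs (monomial, letter), with this pairing as
   orientation reversal, is an oriented torus graph with torus polynomial h. *)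
From HB Require Import structures.
Require Import Defs.
From mathcomp Require Import all_boot all_order all_algebra.
From mathcomp Require Import fingroup perm generic_quotient ring_quotient.
From mathcomp Require Import finmap monalg boolp zify ring.

Set Implicit Arguments.
Unset Strict Implicit.
Unset Printing Implicit Defensive.

Import GRing.Theory.
Local Open Scope ring_scope.
Local Open Scope quotient_scope.

(** * Permutations of words and alternating maps *)

Section Words.
Variables (k : nat) (S : choiceType).
Implicit Types (s t : {ffun 'I_k -> S}) (w : 'S_k).

Definition perm_word s w : {ffun 'I_k -> S} := [ffun i => s (w i)].

Lemma perm_word1 s : perm_word s 1%g = s.
Proof. by apply/ffunP=> i; rewrite ffunE perm1. Qed.

Lemma perm_wordM s u w : perm_word s (u * w)%g = perm_word (perm_word s w) u.
Proof. by apply/ffunP=> i; rewrite !ffunE permM. Qed.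

Lemma perm_wordK s w : perm_word (perm_word s w) w^-1%g = s.
Proof. by rewrite -perm_wordM mulVg perm_word1. Qed.

(** [alternating] speaks of adjacent positions only; induction on the distance of the two positions
    reaches all transpositions. *)
Lemma alternating_tperm (V : zmodType) (f : {ffun 'I_k -> S} -> V) s i j :
  alternating f -> i != j -> f (perm_word s (tperm i j)) = - f s.
Proof.
move=> [_ sw]; wlog lt_ij : i j / (i < j)%N => [IH|_].
  rewrite -val_eqE neq_ltn => /orP[ij|ji]; first by rewrite IH // -val_eqE ltn_eqF.
  by rewrite tpermC IH // -val_eqE ltn_eqF.
have [d dE] : exists d, (j = i + d.+1 :> nat)%N by exists (j - i.+1)%N; lia.
elim: d => [|d IHd] in s j dE lt_ij *; first by apply: sw; lia.
have lt_j : (i + d.+1 < k)%N by have := ltn_ord j; lia.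
pose l := Ordinal lt_j; have il : (i < l)%N by rewrite /=; lia.
have lj : (j = l.+1 :> nat) by rewrite /=; lia.
(* With [l] just before [j], conjugation by the adjacent [tperm l j] shortens the distance by one;
   the three factors give three sign changes. *)
have -> : tperm i j = (tperm l j * tperm i l * tperm l j)%g.
  have -> : (tperm l j * tperm i l * tperm l j = tperm i l ^ tperm l j)%g.
    by rewrite conjgE tpermV mulgA.
  by rewrite tpermJ tpermL tpermD // -val_eqE /=; lia.
rewrite !perm_wordM; have swE s' : perm_word s' (tperm l j) = swap l j s'.
  by apply/ffunP=> a; rewrite !ffunE.
by rewrite swE sw // IHd // swE sw // opprK.
Qed.

Lemma alternating_perm (V : zmodType) (f : {ffun 'I_k -> S} -> V) s w :
  alternating f -> f (perm_word s w) = f s *~ (-1) ^+ w.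
Proof.
move=> alt_f; have [ts -> dts] := prod_tpermP w; elim: ts dts => [|[i j] ts IH] /=.
  by rewrite big_nil perm_word1 odd_perm1.
case/andP=> nij /IH{}IH; rewrite big_cons perm_wordM alternating_tperm // IH.
by rewrite odd_mul_tperm nij signr_addb /= mulN1r mulrNz.
Qed.

(** A transposition brings the second of two equal letters next to the first, where the adjacent
    condition applies. It only costs a sign, which is cancelled by applying it twice, so 2-torsion
    in [V] is harmless. *)
Lemma alternating_eq0 (V : zmodType) (f : {ffun 'I_k -> S} -> V) s :
  alternating f -> ~ injective s -> f s = 0.
Proof.
move=> alt_f; case: (boolP (injectiveb s)) => [/injectiveP//|/injectivePn].
move=> [i [j nij sij]] _; wlog lt_ij : i j nij sij / (i < j)%N => [IH|].
  have := nij; rewrite -val_eqE neq_ltn => /orP[]; first exact: IH.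
  by apply: IH; rewrite // eq_sym.
have lt_k : (i.+1 < k)%N by have := ltn_ord j; lia.
pose l := Ordinal lt_k; have [sq _] := alt_f.
have il : i != l by rewrite -val_eqE /= neq_ltn ltnSn.
have : f (perm_word s (tperm l j)) = 0.
  by apply: (sq _ i l) => //; rewrite !ffunE tpermL tpermD // eq_sym.
rewrite alternating_perm // => /(congr1 (fun x => x *~ (-1) ^+ (tperm l j))).
by rewrite mul0rz -mulrzA -signr_addb addbb mulr1z.
Qed.

Lemma coef_word_id t : injective t -> coef_word t t = 1.
Proof.
move=> inj_t; rewrite /coef_word -[RHS](det1 _ k); congr (\det _).
by apply/matrixP=> i j; rewrite !mxE (inj_eq inj_t).
Qed.

(** A nonzero determinant has a nonzero Leibniz term, whose permutation matches the letters. *)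
Lemma coef_word_neq0 t s : coef_word t s != 0 -> exists w, s = perm_word t w.
Proof.
move=> nz; have [w wP] : exists w : 'S_k, \prod_i (s i == t (w i))%:R != 0 :> int.
  apply/existsP; apply: contraR nz; rewrite negb_exists => /forallP zw.
  rewrite /coef_word /determinant big1 // => w _; have := zw w; rewrite negbK => /eqP w0.
  by under eq_bigr do rewrite mxE; rewrite w0 mulr0.
exists w; apply/ffunP=> i; rewrite ffunE; apply/eqP.
by move/prodf_neq0: wP => /(_ i isT); case: (s i == _).
Qed.

Lemma coef_wordC t s w : coef_word t (perm_word s w) = coef_word t s * (-1) ^+ w.
Proof. by rewrite alternating_perm ?mulrzz //; apply: coef_alternating. Qed.

(* [choose] depends only on the extent of its predicate, so all the permutations
   of s share one representative. *)
Definition canon_word s : {ffun 'I_k -> S} :=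
  choose (fun t => [exists w, t == perm_word s w]) s.

Lemma canon_wordP s : exists w, canon_word s = perm_word s w.
Proof.
have /existsP[w /eqP wE] : [exists w, canon_word s == perm_word s w].
  rewrite /canon_word; apply: (chooseP (P := fun t => [exists w, t == perm_word s w])).
  by apply/existsP; exists 1%g; rewrite perm_word1.
by exists w.
Qed.

Lemma canon_word_perm s w : canon_word (perm_word s w) = canon_word s.
Proof.
rewrite /canon_word.
rewrite (@eq_choose _ _ (fun t => [exists w0, t == perm_word s w0])).
  by apply: choose_id; apply/existsP; [exists w|exists 1%g; rewrite perm_word1].
move=> t; apply/existsP/existsP => -[u /eqP->].
  by exists (u * w)%g; rewrite perm_wordM.
by exists (u * w^-1)%g; rewrite -perm_wordM mulgKV.
Qed.

Lemma canon_word_coef s : injective s ->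
  exists2 w, s = perm_word (canon_word s) w & coef_word (canon_word s) s = (-1) ^+ w.
Proof.
move=> inj_s; have [w wE] := canon_wordP s.
have inj_c : injective (canon_word s).
  by rewrite wE => a b; rewrite !ffunE => /inj_s/perm_inj.
have sE : s = perm_word (canon_word s) w^-1%g by rewrite wE perm_wordK.
by exists w^-1%g => //; rewrite [X in coef_word _ X]sE coef_wordC coef_word_id ?mul1r.
Qed.

Lemma coef_canon_word_neq0 t s :
  coef_word (canon_word t) s != 0 -> canon_word s = canon_word t.
Proof.
move=> /coef_word_neq0[w ->]; rewrite canon_word_perm.
by have [u uE] := canon_wordP t; rewrite {1}uE canon_word_perm.
Qed.

End Words.

(** * Normal forms in the exterior power *)

Section Coefficients.
Variables (k : nat) (S : choiceType).
Implicit Types (x y : ext k S) (s t : {ffun 'I_k -> S}).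

Lemma ext_lift_sum (V : zmodType) (f : {ffun 'I_k -> S} -> V) (I : Type)
    (r : seq I) (P : pred I) (F : I -> ext k S) : alternating f ->
  ext_lift f (\sum_(i <- r | P i) F i) = \sum_(i <- r | P i) ext_lift f (F i).
Proof.
move=> alt_f; pose g := GRing.isZmodMorphism.Build _ _ _ (ext_liftB alt_f).
pose h : {additive ext k S -> V} := HB.pack (ext_lift f) g.
exact: (raddf_sum h).
Qed.

Lemma ext_liftMz (V : zmodType) (f : {ffun 'I_k -> S} -> V) x (c : int) :
  alternating f -> ext_lift f (x *~ c) = ext_lift f x *~ c.
Proof.
move=> alt_f; pose g := GRing.isZmodMorphism.Build _ _ _ (ext_liftB alt_f).
pose h : {additive ext k S -> V} := HB.pack (ext_lift f) g.
exact: (raddfMz h).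
Qed.

Lemma ext_wedge_sum x :
  exists m : {malg int[{ffun 'I_k -> S}]},
    x = \sum_(s <- msupp m) wedge s *~ m@_s.
Proof.
elim/quotW: x => m; exists m; rewrite {1}[m]monalgE.
have piB : zmod_morphism \pi_(ext k S) by move=> a b; rewrite !piE.
pose g := GRing.isZmodMorphism.Build _ _ _ piB.
pose p : {additive {malg int[{ffun 'I_k -> S}]} -> ext k S} := HB.pack \pi_(ext k S) g.
rewrite -[\pi_ _ _]/(p _) raddf_sum; apply: eq_bigr => s _.
rewrite -raddfMz; congr (p _); apply/malgP => t.
by rewrite -[LHS]/(mcoeff t _) -[RHS]/(mcoeff t _) raddfMz /= !mcoeffU mulrzz mulr_natl.
Qed.

(** Monomials with a repeated letter vanish, and each other one is its canonical monomial up to a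
    sign. Collecting terms by canonical word leaves the coefficients, so these determine the
    element. *)
Lemma ext_sum_coef x :
  exists T : seq {ffun 'I_k -> S}, x = \sum_(t <- T) wedge t *~ coef t x.
Proof.
have [m xE] := ext_wedge_sum x.
pose D := [seq s : {ffun 'I_k -> S} <- msupp m | injectiveb s].
have {}xE : x = \sum_(s <- D) wedge s *~ m@_s.
  rewrite xE big_filter [RHS]big_mkcond; apply: eq_bigr => s _.
  case: injectiveP => // /(alternating_eq0 (@wedge_alternating k S)) ->.
  by rewrite mul0rz.
exists (undup (map (@canon_word k S) D)).
have cE t : coef t x = \sum_(s <- D) coef_word t s * m@_s.
  rewrite xE /coef ext_lift_sum; last exact: coef_alternating.
  apply: eq_bigr => s _; rewrite ext_liftMz; last exact: coef_alternating.
  by rewrite ext_lift_wedge ?mulrzz //; apply: coef_alternating.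
have sE s : s \in D -> wedge s = wedge (canon_word s) *~ coef_word (canon_word s) s.
  rewrite mem_filter => /andP[/injectiveP inj_s _].
  have [w sE ->] := canon_word_coef inj_s; rewrite {1}sE.
  exact/alternating_perm/wedge_alternating.
transitivity (\sum_(t <- undup (map (@canon_word k S) D))
   \sum_(s <- D | canon_word s == t) wedge s *~ m@_s).
  rewrite (exchange_big_dep xpredT) //= [LHS]xE big_seq [RHS]big_seq.
  apply: eq_bigr => s sD.
  rewrite big_mkcond (bigD1_seq (canon_word s)) ?undup_uniq ?mem_undup ?map_f //=.
  by rewrite eqxx big1 ?addr0 // => t /negbTE; rewrite eq_sym => ->.
rewrite big_seq [RHS]big_seq; apply: eq_bigr => t.
rewrite mem_undup => /mapP[t0 _ ->{t}]; rewrite cE.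
rewrite mulrz_sumr (bigID (fun s => canon_word s == canon_word t0) xpredT) /=.
rewrite [X in _ = _ + X]big1 ?addr0 => [|s ns].
  rewrite big_seq_cond [RHS]big_seq_cond; apply: eq_bigr => s /andP[sD /eqP <-].
  by rewrite mulrzA -sE.
(* A word outside the class of [t0] contributes nothing to the coefficient. *)
have [->|/coef_canon_word_neq0/eqP nz] := eqVneq (coef_word (canon_word t0) s) 0.
  by rewrite mul0r mulr0z.
by rewrite nz in ns.
Qed.

Lemma ext_coef_eq0 x : (forall t, coef t x = 0) -> x = 0.
Proof.
by move=> c0; have [T ->] := ext_sum_coef x; rewrite big1 // => t _; rewrite c0 mulr0z.
Qed.

Lemma coef_extMz t x c : coef t (x *~ c) = coef t x * c.
Proof. by rewrite /coef ext_liftMz ?mulrzz //; apply: coef_alternating. Qed.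

Lemma coef_wedge t s : coef t (wedge s) = coef_word t s.
Proof. by rewrite /coef ext_lift_wedge //; apply: coef_alternating. Qed.

Lemma coef_ext_sum t (I : Type) (r : seq I) (P : pred I) (F : I -> ext k S) :
  coef t (\sum_(i <- r | P i) F i) = \sum_(i <- r | P i) coef t (F i).
Proof. by rewrite /coef ext_lift_sum //; apply: coef_alternating. Qed.

(* The coefficients embed the exterior power into a power of Z. *)
Lemma ext_eqN0 x : x = - x -> x = 0.
Proof.
move=> xN; apply: ext_coef_eq0 => t; have := congr1 (coef t) xN.
by rewrite -[- x]/(x *~ -1) coef_extMz; lia.
Qed.

End Coefficients.

(** * Bases congruent modulo one vector and faces of their dual bases *)

Section BasisChange.
Variables (n : nat) (j : 'I_n) (k : 'I_n -> int).

(** Left multiplication by this matrix is the general change of rows modulo row [j]. *)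
Definition column_mx : 'M[int]_n :=
  \matrix_(a, b) (if b == j then k a else (a == b)%:R).

Lemma row_column_mx (M : 'M[int]_n) a :
  row a (column_mx *m M) = (a != j)%:R *: row a M + k a *: row j M.
Proof.
rewrite row_mul mulmx_sum_row (bigD1 j) //= !mxE eqxx addrC; congr (_ + _).
have [->|na] := eqVneq a j.
  by rewrite scale0r big1 // => b /negbTE nb; rewrite !mxE nb eq_sym nb scale0r.
rewrite (bigD1 a) //= !mxE (negbTE na) eqxx big1 ?addr0 // => b /andP[/negbTE nb].
by rewrite !mxE nb eq_sym => /negbTE ->; rewrite scale0r.
Qed.

Lemma det_column_mx : \det column_mx = k j.
Proof.
rewrite (expand_det_row _ j) (bigD1 j) //= big1 => [|b nb]; last first.
  by rewrite mxE (negbTE nb) eq_sym (negbTE nb) mul0r.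
rewrite addr0 mxE eqxx /cofactor addnn -signr_odd odd_double mul1r.
rewrite (_ : row' _ _ = 1%:M) ?det1 ?mulr1 //.
by apply/matrixP=> a b; rewrite !mxE eq_sym (negbTE (neq_lift _ _)) (inj_eq lift_inj).
Qed.

End BasisChange.

Section Transition.
Variables (n : nat) (j : 'I_n) (w : 'S_n) (M N : 'M[int]_n).
Hypotheses (uM : M \in unitmx) (uN : N \in unitmx).

Lemma row_perm_inv : col_perm w (invmx M) *m row_perm w M = 1%:M.
Proof.
apply: mulmx1C; apply/matrixP=> a b.
have /matrixP/(_ (w a) (w b)) := mulmxV uM; rewrite !mxE (inj_eq perm_inj) => <-.
by apply: eq_bigr => c _; rewrite !mxE.
Qed.

(** Both sides say that [N], multiplied by the inverse of the permuted [M], agrees with the identity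
    outside column [j], that is, has the form [column_mx j k]. *)
Lemma col_inv_transition :
  (forall b, b != j -> col b (invmx N) = col (w b) (invmx M)) <->
  exists k : 'I_n -> int, forall a,
    row a N = (a != j)%:R *: row (w a) M + k a *: row (w j) M.
Proof.
have rowE a : row a (row_perm w M) = row (w a) M by apply/rowP=> b; rewrite !mxE.
split=> [colE|[k kE]].
  pose k a := (N *m col_perm w (invmx M)) a j.
  exists k => a; rewrite -!rowE -row_column_mx; congr row.
  rewrite -[LHS]mulmx1 -row_perm_inv mulmxA; congr (_ *m _).
  apply/matrixP=> c b; rewrite [RHS]mxE; case: eqVneq => [->//|/colE/colP bE].
  have /matrixP/(_ c b) := mulmxV uN; rewrite [in X in _ = X -> _]mxE => <-.
  rewrite !mxE; apply: eq_bigr => l _; have := bE l; rewrite !mxE => ->; exact.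
have {kE} NE : N = column_mx j k *m row_perm w M.
  by apply/row_matrixP=> a; rewrite row_column_mx !rowE.
(* The columns of [column_mx j k] other than column [j] are unit vectors, so they pick out columns
   of [invmx N]. *)
have DE : invmx N *m column_mx j k = col_perm w (invmx M).
  have : invmx N *m column_mx j k *m row_perm w M = 1%:M by rewrite -mulmxA -NE mulVmx.
  move/(congr1 (fun X => X *m col_perm w (invmx M))).
  by rewrite -mulmxA (mulmx1C row_perm_inv) mulmx1 mul1mx.
move=> b nb; apply/colP=> l; have /matrixP/(_ l b) := DE.
rewrite !mxE => <-; rewrite (bigD1 b) //= !mxE (negbTE nb) eqxx mulr1 big1 ?addr0 //.
by move=> c /negbTE nc; rewrite !mxE (negbTE nb) nc mulr0.
Qed.

Lemma det_transition (k : 'I_n -> int) :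
  (forall a, row a N = (a != j)%:R *: row (w a) M + k a *: row (w j) M) ->
  \det N = k j * (-1) ^+ w * \det M.
Proof.
move=> kE; have -> : N = column_mx j k *m row_perm w M.
  apply/row_matrixP=> a; rewrite row_column_mx kE.
  by congr (_ *: _ + _ *: _); apply/rowP=> b; rewrite !mxE.
by rewrite row_permE !det_mulmx det_column_mx det_perm mulrA.
Qed.

End Transition.

(** Restricts a matching of two bases that pairs [j] with [i] to the faces obtained by deleting
    these positions. *)
Lemma lift_perm_exists m (j i : 'I_m.+1) (w : 'S_m.+1) :
  w j = i -> exists u, w = lift_perm j i u.
Proof.
move=> wj; have /fin_all_exists[u uE] (a : 'I_m) : exists b, w (lift j a) = lift i b.
  have : i != w (lift j a) by rewrite -wj (inj_eq perm_inj) neq_lift.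
  by move=> /unlift_some[b bE _]; exists b.
have inj_u : injective u.
  by move=> a b uab; apply: (@lift_inj _ j); apply: (@perm_inj _ w); rewrite !uE uab.
exists (perm inj_u); apply/permP=> a; case: (unliftP j a) => [b|] ->.
  by rewrite lift_perm_lift permE.
by rewrite lift_perm_id.
Qed.

Section Faces.
Variables (m : nat) (s1 s2 : {ffun 'I_m.+1 -> J m.+1}) (i j : 'I_m.+1) (w : 'S_m).
Hypotheses (b1 : basis_word s1) (b2 : basis_word s2).

(** Translates equality of dual faces up to order into the congruence axiom along an edge. It is
    [col_inv_transition] with [w] extended by sending [j] to [i]. *)
Lemma face_transition :
  delete j (dual_word b2) = perm_word (delete i (dual_word b1)) w <->
  exists k : 'I_m.+1 -> int, forall a,
    val (s2 a) = (a != j)%:R *: val (s1 (lift_perm j i w a)) + k a *: val (s1 i).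
Proof.
have /Zbasis_unitmx u1 := b1; have /Zbasis_unitmx u2 := b2.
have := col_inv_transition j (lift_perm j i w) u1 u2.
rewrite lift_perm_id => E; split=> [dE|[k kE]].
  have [|k kE] := E.1.
    move=> b; case: (unliftP j b) => [a ->|->] nj; last by rewrite eqxx in nj.
    move/ffunP/(_ a)/(congr1 val): dE; rewrite !ffunE /= => ->.
    by rewrite lift_perm_lift.
  by exists k => a; have := kE a; rewrite !rowK.
have /E colE : exists k : 'I_m.+1 -> int, forall a, row a (word_mx s2) =
    (a != j)%:R *: row (lift_perm j i w a) (word_mx s1) + k a *: row i (word_mx s1).
  by exists k => a; rewrite !rowK.
apply/ffunP=> a; apply/val_inj; rewrite !ffunE /= colE 1?eq_sym ?neq_lift //.
by rewrite lift_perm_lift.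
Qed.

(** The sign of [lift_perm j i w] contains the signs of positions [i] and [j] in the boundary; this
    ties orientations to the signs of faces. *)
Lemma det_face_transition (k : 'I_m.+1 -> int) :
  (forall a, val (s2 a) =
    (a != j)%:R *: val (s1 (lift_perm j i w a)) + k a *: val (s1 i)) ->
  \det (word_mx s2) = k j * ((-1) ^+ i * (-1) ^+ j * (-1) ^+ w) * \det (word_mx s1).
Proof.
move=> kE; rewrite (@det_transition _ j (lift_perm j i w) (word_mx s1) _ k).
  by rewrite odd_lift_perm !signr_addb !signr_odd [(-1) ^+ j * _]mulrC.
by move=> a; rewrite lift_perm_id !rowK.
Qed.

End Faces.

(** * Signed sums of basis monomials and their boundary *)

Lemma det_basis_word n (s : {ffun 'I_n -> J n}) :
  basis_word s -> \det (word_mx s) = 1 \/ \det (word_mx s) = -1.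
Proof.
by move=> /Zbasis_unitmx; rewrite unitmxE => /orP[]/eqP; [left|right].
Qed.

(** The pairs of a monomial and a position index the faces; they play the role of oriented edges in
    both implications. *)
Lemma boundary_dual_sum n (I : finType) (s : I -> {ffun 'I_n -> J n})
    (bs : forall p, basis_word (s p)) (c : I -> int) :
  boundary (dual (\sum_p wedge (s p) *~ c p)) =
  \sum_(x : I * 'I_n) wedge (delete x.2 (dual_word (bs x.1))) *~ (c x.1 * (-1) ^+ x.2).
Proof.
rewrite /boundary /dual (ext_lift_sum _ _ _ (@dual_alternating n)).
rewrite (ext_lift_sum _ _ _ (@boundary_alternating n _)).
transitivity (\sum_p \sum_i wedge (delete i (dual_word (bs p))) *~ (c p * (-1) ^+ i)).
  apply: eq_bigr => p _.
  rewrite (ext_liftMz _ _ (@dual_alternating n)).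
  rewrite (ext_liftMz _ _ (@boundary_alternating n _)).
  rewrite (ext_lift_wedge (@dual_alternating n)).
  rewrite /dual_monomial; case: pselect => // b.
  rewrite (ext_lift_wedge (@boundary_alternating n _)).
  rewrite /boundary_word mulrz_suml; apply: eq_bigr => i _.
  by rewrite -mulrzA mulrC (Prop_irrelevance b (bs p)).
by rewrite pair_big.
Qed.

Lemma faithful_sum n (h : ext n (J n)) : faithful h ->
  exists m (s : 'I_m -> {ffun 'I_n -> J n}) (b : 'I_m -> bool),
    (forall p, basis_word (s p)) /\ h = \sum_p wedge (s p) *~ (-1) ^+ b p.
Proof.
move=> fh; pose dec (x : ext n (J n)) := exists2 l : seq ({ffun 'I_n -> J n} * bool),
  (forall y, y \in l -> basis_word y.1) & x = \sum_(y <- l) wedge y.1 *~ (-1) ^+ y.2.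
suff [l bl ->] : dec h.
  exists (size l), (fun p => (tnth (in_tuple l) p).1), (fun p => (tnth (in_tuple l) p).2).
  split; first by move=> p; apply: bl; rewrite -[in X in _ \in X](in_tupleE l) mem_tnth.
  by rewrite [in LHS](big_tnth _ _ l).
have [T ->] := ext_sum_coef h; apply: (big_ind dec) => [|_ _ [l bl ->] [l' bl' ->]|t _].
- by exists [::] => //; rewrite big_nil.
- exists (l ++ l'); last by rewrite big_cat.
  by move=> y; rewrite mem_cat => /orP[/bl|/bl'].
(* A coefficient becomes as many equally signed copies of its word as its absolute value, one per
   future vertex; a zero coefficient gives the empty list. *)
exists (nseq `|coef t h| (t, coef t h < 0)) => [y|].
  by rewrite mem_nseq => /andP[nz /eqP->]; apply: fh; rewrite -absz_gt0.
rewrite big_nseq iter_addr addr0 /= pmulrn -mulrzA; congr (_ *~ _).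
by rewrite [LHS]intEsign.
Qed.

(** * From congruence of sets to a permutation *)

(** Pairing with the dual vector of [s b] kills the right side, but gives [1] on the left if [b] and
    [b'] differ. *)
Lemma basis_word_congr n (s : {ffun 'I_n -> J n}) (i b b' : 'I_n) (x : int) :
  basis_word s -> val (s b) - val (s b') = x *: val (s i) -> b != i -> b = b'.
Proof.
move=> bs sE nbi; apply/esym/eqP; apply: contraTT isT => nb.
have := congr1 (pairing (val (dual_word bs b))) sE.
have pB u v : pairing (val (dual_word bs b)) (u - v) =
    pairing (val (dual_word bs b)) u - pairing (val (dual_word bs b)) v.
  by rewrite /pairing mulmxBl !mxE.
have pZ u : pairing (val (dual_word bs b)) (x *: u) =
    x * pairing (val (dual_word bs b)) u.
  by rewrite /pairing -scalemxAl mxE.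
rewrite pB pZ !pairing_dual_word eqxx (negbTE nb) eq_sym (negbTE nbi).
by rewrite mulr0.
Qed.

(** Letters of a basis stay distinct modulo another of its letters, so a choice [f] of congruent
    letters is injective, hence a permutation. *)
Lemma congr_transition m (s1 s2 : {ffun 'I_m.+1 -> J m.+1}) i j (c : int) :
    basis_word s1 -> basis_word s2 -> c = 1 \/ c = -1 ->
    val (s2 j) = c *: val (s1 i) ->
    (forall a, exists b x, val (s2 a) - val (s1 b) = x *: val (s1 i)) ->
  exists (w : 'S_m) k, k j = c /\ forall a,
    val (s2 a) = (a != j)%:R *: val (s1 (lift_perm j i w a)) + k a *: val (s1 i).
Proof.
move=> b1 b2 c1 sj /fin_all_exists[f] /fin_all_exists[x fE].
(* As [s2 j] is a multiple of [s1 i], so is the congruent letter [s1 (f j)]. *)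
have fj : f j = i.
  have [//|nf] := eqVneq (f j) i.
  apply: (basis_word_congr (x := c - x j - 1) b1 _ nf).
  rewrite !scalerBl -sj -fE scale1r; congr (_ - _).
  by rewrite opprB addrC subrK.
have siE : val (s1 i) = c *: val (s2 j).
  by rewrite sj scalerA; case: c1 => ->; rewrite ?mulrNN mulr1 scale1r.
have inj_f : injective f.
  have aux a a' : f a = f a' -> a != j -> a = a'.
    move=> faa na; apply: (basis_word_congr (x := (x a - x a') * c) b2 _ na).
    rewrite -scalerA -siE scalerBl -!fE faa opprB addrA; congr (_ - _).
    by rewrite subrK.
  move=> a a' faa; have [aj|] := eqVneq a j; last exact: aux.
  have [->//|na'] := eqVneq a' j; exact/esym/aux.
have [|w wE] := @lift_perm_exists _ j i (perm inj_f); first by rewrite permE.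
(* At [j] the summand [s1 i] is dropped from the formula, so the coefficient there is [c], whereas
   [x j] is [c - 1]. *)
exists w, (fun a => if a == j then c else x a); rewrite eqxx; split=> // a.
rewrite -wE permE; have [->|na] := eqVneq a j; first by rewrite scale0r add0r.
by rewrite scale1r -fE addrC subrK.
Qed.

(** * Enumerations of the edges at a vertex, and its monomial *)

Lemma Zbasis_bij n (I K : finType) (f : K -> I) (v : I -> 'rV[int]_n)
    (u : K -> 'rV[int]_n) :
  bijective f -> (forall i, u i = v (f i)) -> is_Zbasis v -> is_Zbasis u.
Proof.
move=> [g fK gK] uE bv x; have [c [-> uc]] := bv x.
have bf : {on predT, bijective f} by exists g => i _; [apply: fK|apply: gK].
exists [ffun i => c (f i)]; split.
  by rewrite (reindex f) //=; apply: eq_bigr => i _; rewrite ffunE uE.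
move=> d dE; apply/ffunP=> i; rewrite ffunE -[in RHS](fK i).
have -> : c = [ffun i => d (g i)].
  apply: uc; rewrite dE [RHS](reindex f) //=.
  by apply: eq_bigr => l _; rewrite ffunE fK uE.
by rewrite ffunE !fK.
Qed.

Section Enumeration.
Variables (n : nat) (G : multigraph) (alpha : edge G -> 'rV[int]_n).
Variables (p : vertex G) (es : {ffun 'I_n -> edge G}).
Hypothesis esP : perm_eq (codom es) (enum (edges_at p)).

Lemma enumeration_mem i : es i \in edges_at p.
Proof. by rewrite -mem_enum -(perm_mem esP) codom_f. Qed.

Lemma enumerationP e : e \in edges_at p -> exists i, e = es i.
Proof. by rewrite -mem_enum -(perm_mem esP) => /codomP. Qed.

Lemma enumeration_inj : injective es.
Proof.
by apply/injectiveP; rewrite /injectiveb /dinjectiveb (perm_uniq esP) enum_uniq.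
Qed.

Lemma enumeration_basis :
  is_Zbasis (fun i => alpha (es i)) <->
  is_Zbasis (fun e : {e : edge G | e \in edges_at p} => alpha (val e)).
Proof.
pose f i : {e | e \in edges_at p} := Sub (es i) (enumeration_mem i).
have [g fK gK] : bijective f.
  apply: inj_card_bij => [a b /(congr1 val)/enumeration_inj//|].
  by rewrite card_sig card_ord -[n]card_ord -(size_codom es) (perm_size esP) -cardE.
split; first apply: (Zbasis_bij (f := g)); [by exists f| |].
  by move=> e; rewrite -[in LHS](gK e).
by apply: (Zbasis_bij (f := f)); [exists g|].
Qed.

End Enumeration.

Lemma perm_word_exists k (T : choiceType) (s t : {ffun 'I_k -> T}) :
  injective s -> (forall i, exists j, s i = t j) -> exists w, s = perm_word t w.
Proof.
move=> inj_s /fin_all_exists[f fE].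
have inj_f : injective f by move=> a b fab; apply: inj_s; rewrite !fE fab.
by exists (perm inj_f); apply/ffunP=> i; rewrite ffunE permE.
Qed.

Section Vertices.
Variables (n : nat) (G : torus_graph n).
Implicit Types es : {ffun 'I_n -> edge G}.

Definition axial_word es : {ffun 'I_n -> J n} :=
  [ffun i => axialJ (es i)].

Lemma axial_detE es : axial_det es = \det (word_mx (axial_word es)).
Proof.
by rewrite -det_tr; congr (\det _); apply/matrixP=> i j; rewrite !mxE ffunE.
Qed.

Lemma axial_word_basis p es : enumerates p es -> basis_word (axial_word es).
Proof.
move=> esP; have := (enumeration_basis (axial (t := G)) esP).2 (axial_basis (axialP G) p).
by apply: (Zbasis_bij (f := id)) => [|i]; [exists id|rewrite ffunE].
Qed.

Lemma enumerates_exists p : exists es : {ffun 'I_n -> edge G}, enumerates p es.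
Proof.
have sz : size (enum (edges_at p)) == n by rewrite -cardE tgraph_regular.
exists [ffun i => tnth (Tuple sz) i]; rewrite /enumerates.
rewrite -[X in perm_eq _ X]/(tval (Tuple sz)) -[X in perm_eq _ X]map_tnth_enum.
by rewrite (eq_codom (g := tnth (Tuple sz))) // => i; rewrite ffunE.
Qed.

(** Reordering multiplies the monomial and the determinant by the same sign. *)
Lemma axial_wedge_det p es es' : enumerates p es -> enumerates p es' ->
  axial_wedge es *~ axial_det es = axial_wedge es' *~ axial_det es'.
Proof.
move=> esP esP'; have [i|w wE] := perm_word_exists (enumeration_inj esP) (t := es').
  by apply: (enumerationP esP'); apply: (enumeration_mem esP).
have -> : axial_det es = (-1) ^+ w * axial_det es'.
  rewrite !axial_detE -det_perm -det_mulmx -row_permE; congr (\det _).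
  by apply/matrixP=> i j; rewrite wE !mxE !ffunE.
have -> : axial_wedge es = axial_wedge es' *~ (-1) ^+ w.
  rewrite -(alternating_perm _ _ (@wedge_alternating n _)); congr wedge.
  by apply/ffunP=> i; rewrite wE !ffunE.
by rewrite -mulrzA mulrA -signr_addb addbb mul1r.
Qed.

(* Every enumeration of the edges at p has determinant 1 or -1, so the second
   case of [vertex_monomial], where no enumeration has determinant sigma(p), also
   follows this formula. *)
Lemma vertex_monomialE (sigma : vertex G -> int) p es :
    enumerates p es -> sigma p = 1 \/ sigma p = -1 ->
  vertex_monomial sigma p = axial_wedge es *~ (sigma p * axial_det es).
Proof.
move=> esP s1; rewrite mulrC mulrzA.
have d1 es' : enumerates p es' -> axial_det es' = 1 \/ axial_det es' = -1.
  by move/axial_word_basis/det_basis_word; rewrite -axial_detE.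
rewrite /vertex_monomial; case: pickP => [es' /andP[esP' /eqP d']|nd].
  rewrite (axial_wedge_det esP esP') d' -mulrzA.
  by case: s1 => ->; rewrite ?mulrNN mulr1.
case: pickP => [es' esP'|/(_ es)]; last by rewrite esP.
have := nd es'; rewrite esP' /= (axial_wedge_det esP esP') -mulrzA.
case: (d1 _ esP') => ->; case: s1 => ->; rewrite ?eqxx // => _.
Qed.

End Vertices.

(** * Cancellation of faces in pairs *)

(** The sum equals its own negative, and the exterior power has no 2-torsion. *)
Lemma sumr_involution0 k (S : choiceType) (I : finType) (r : I -> I) (F : I -> ext k S) :
  involutive r -> (forall x, F (r x) = - F x) -> \sum_x F x = 0.
Proof.
move=> rK FN; apply: ext_eqN0; rewrite {1}(reindex_inj (inv_inj rK)) -sumrN.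
by apply: eq_bigr => x _; apply: FN.
Qed.

Lemma boundary_dual_torus_polynomial m (G : torus_graph m.+1) (sigma : vertex G -> int) :
  is_orientation sigma -> boundary (dual (torus_polynomial sigma)) = 0.
Proof.
case=> s1 sN; have [es esP] := fin_all_exists (@enumerates_exists _ G).
have bs p := axial_word_basis (esP p).
have -> : torus_polynomial sigma =
    \sum_p wedge (axial_word (es p)) *~ (sigma p * axial_det (es p)).
  by apply: eq_bigr => p _; apply: vertex_monomialE.
rewrite (boundary_dual_sum bs); pose E (x : vertex G * 'I_m.+1) := es x.1 x.2.
have Einit x : init (E x) = x.1.
  by have := enumeration_mem (esP x.1) x.2; rewrite inE => /eqP.
(* [R] inverts [E], so the faces are indexed by the oriented edges and reversal of edges acts on
   them. *)
have /fin_all_exists[R RE] e : exists x, E x = e.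
  have [|i iE] := enumerationP (esP (init e)) (e := e); first by rewrite inE.
  by exists (init e, i).
have ER x : R (E x) = x.
  have := Einit (R (E x)); rewrite RE Einit => Ei.
  case: x (R (E x)) (RE (E x)) Ei => p i [q j] /= EE pq.
  by move: EE; rewrite -pq /E /= => /(enumeration_inj (esP p)) ->.
apply: (@sumr_involution0 _ _ _ (fun x => R (reverse (E x)))) => [x|[p i]].
  by rewrite RE reverseK ER.
have := RE (reverse (E (p, i))); case: (R _) => q j /= Eqj.
have qE : q = term (E (p, i)) by rewrite /term -Eqj Einit.
have pE : p = init (E (p, i)) by rewrite Einit.
have axE p0 a : val (axial_word (es p0) a) = axial (E (p0, a)) by rewrite ffunE.
have [c c1 cE] : exists2 c : int, c = 1 \/ c = -1 &
    axial (E (q, j)) = c *: axial (E (p, i)).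
  rewrite Eqj; case: (axial_reverse (axialP G) (E (p, i))) => ->.
    by exists 1; rewrite ?scale1r; auto.
  by exists (-1); rewrite ?scaleN1r; auto.
have [||w [k [kj kE]]] := congr_transition (bs p) (bs q) (i := i) (j := j) c1.
- by rewrite !axE.
- move=> a; have [cg _] := axial_congr (axialP G) (E (p, i)).
  have [|e2] := cg (E (q, a)); first by rewrite -qE inE Einit.
  rewrite -pE => /(enumerationP (esP p))[b ->] [x xE].
  by exists b, x; rewrite !axE.
have /face_transition/= -> : exists k, forall a, val (axial_word (es q) a) =
    (a != j)%:R *: val (axial_word (es p) (lift_perm j i w a)) +
    k a *: val (axial_word (es p) i) by exists k.
rewrite (alternating_perm _ _ (@wedge_alternating _ _)) -mulrzA -mulrNz; congr (_ *~ _).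
rewrite !axial_detE (det_face_transition kE) kj.
(* The orientation condition, with the nonzero vector [axial (E (p, i))] cancelled. *)
have scE : sigma p = - (sigma q * c).
  have := sN (E (p, i)); rewrite -[init (reverse _)]qE -pE -Eqj cE scalerA -scaleNr.
  move/eqP; rewrite -subr_eq0 -scalerBl scalemx_eq0 (negbTE (axial_neq0 _)) orbF.
  by rewrite subr_eq0 => /eqP.
rewrite scE -![(-1) ^+ nat_of_ord _]signr_odd.
by case: (odd i); case: (odd j); case: (odd_perm w); rewrite ?expr0 ?expr1; ring.
Qed.

(* Within each fibre of f, the positive and the negative elements are enumerated,
   and elements of the same rank are exchanged. *)
Lemma sign_matching (E : finType) (T : eqType) (f : E -> T) (g : E -> bool) :
    (forall t, #|[pred x | (f x == t) && g x]| = #|[pred x | (f x == t) && ~~ g x]|) ->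
  exists2 r : E -> E, involutive r & forall x, f (r x) = f x /\ g (r x) = ~~ g x.
Proof.
move=> card_fg; pose cls t b := enum [pred x | (f x == t) && (g x == b)].
have size_cls t b b' : size (cls t b) = size (cls t b').
  have sz : size (cls t true) = size (cls t false).
    rewrite -!cardE; transitivity #|[pred x | (f x == t) && g x]|; last rewrite card_fg.
      by apply: eq_card => x; rewrite !inE; case: (g x).
    by apply: eq_card => x; rewrite !inE; case: (g x).
  by case: b b' => -[].
have mem_cls t b x : (x \in cls t b) = (f x == t) && (g x == b) by rewrite mem_enum.
pose r x := nth x (cls (f x) (~~ g x)) (index x (cls (f x) (g x))).
have idx x : (index x (cls (f x) (g x)) < size (cls (f x) (~~ g x)))%N.
  by rewrite (size_cls _ _ (g x)) index_mem mem_cls !eqxx.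
have rP x : f (r x) = f x /\ g (r x) = ~~ g x.
  by have := mem_nth x (idx x); rewrite mem_cls => /andP[/eqP ? /eqP].
exists r => // x; have [fr gr] := rP x.
rewrite {1}/r fr gr negbK [X in nth _ _ X]index_uniq ?enum_uniq //.
by rewrite nth_index // mem_cls !eqxx.
Qed.

(** Relative to its canonical word a term has sign exponent [sg x (+) u x]. The coefficient of a
    class is the number of its positive terms minus that of its negative terms, so both numbers
    agree and [sign_matching] applies. *)
Lemma wedge_sum0_matching k (S : choiceType) (I : finType)
    (F : I -> {ffun 'I_k -> S}) (sg : I -> bool) :
    (forall x, injective (F x)) -> \sum_x wedge (F x) *~ (-1) ^+ sg x = 0 ->
  exists r : I -> I, [/\ involutive r, forall x, r x != x &
    forall x, exists w, F (r x) = perm_word (F x) w /\ sg (r x) (+) w = ~~ sg x].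
Proof.
move=> inj_F F0; have /fin_all_exists2[u uE uC] x := canon_word_coef (@inj_F x).
have card_fg t : #|[pred x | (canon_word (F x) == t) && (sg x (+) u x)]| =
    #|[pred x | (canon_word (F x) == t) && ~~ (sg x (+) u x)]|.
  have [x0 /= /eqP x0t|no] := pickP [pred x | canon_word (F x) == t]; last first.
    by rewrite !eq_card0 // => x; rewrite !inE; have /= -> := no x.
  have := congr1 (coef t) F0.
  rewrite coef_ext_sum -[X in _ = coef _ X](mulr0z (wedge (F x0))).
  rewrite coef_extMz mulr0 (bigID [pred x | canon_word (F x) == t]) /= addrC.
  rewrite big1 ?add0r => [|x nx]; last first.
    rewrite coef_extMz coef_wedge.
    have [->|] := eqVneq (coef_word t (F x)) 0; first by rewrite mul0r.
    by rewrite -x0t => /coef_canon_word_neq0; rewrite x0t => /eqP; rewrite (negbTE nx).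
  rewrite (bigID (fun x => sg x (+) u x)) /=.
  have tE x : canon_word (F x) == t ->
      coef t (wedge (F x) *~ (-1) ^+ sg x) = (-1) ^+ (sg x (+) u x).
    by move=> /eqP <-; rewrite coef_extMz coef_wedge uC -signr_addb addbC.
  rewrite (eq_bigr (fun=> -1)) => [|x /andP[/tE-> ->] //].
  rewrite [X in _ + X](eq_bigr (fun=> 1)) => [|x /andP[/tE-> /negbTE-> //]].
  rewrite !sumr_const mulNrn => /eqP.
  by rewrite addrC subr_eq0 Num.Theory.eqr_nat => /eqP/esym.
have [r rK rP] := sign_matching card_fg; exists r; split=> // [x|x].
  by apply/eqP => rx; have [_] := rP x; rewrite rx; case: (_ (+) _).
(* Both words are permutations of one canonical word, by [u (r x)] and [u x]. *)
have [fr gr] := rP x; exists (u (r x) * (u x)^-1)%g; split.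
  have -> : F (r x) = perm_word (canon_word (F x)) (u (r x)) by rewrite -fr -uE.
  by rewrite perm_wordM {2}uE perm_wordK.
by rewrite odd_permM odd_permV addbA gr; case: (sg x); case: (odd_perm _).
Qed.

Lemma torus_graph_of_boundary0 m (h : ext m.+1 (J m.+1)) :
    faithful h -> boundary (dual h) = 0 ->
  exists (G : torus_graph m.+1) (sigma : vertex G -> int),
    is_orientation sigma /\ h = torus_polynomial sigma.
Proof.
move=> fh; have [N [s [b [bs ->]]]] := faithful_sum fh; rewrite (boundary_dual_sum bs).
under eq_bigr do rewrite -[X in _ * X]signr_odd -signr_addb.
(* The letters of a face are distinct because their pairings with the original basis differ. *)
case/wedge_sum0_matching => [x a a'|r [rK rneq rP]].
  rewrite ffunE [RHS]ffunE => dE; apply: (@lift_inj _ x.2).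
  have := pairing_dual_word (bs x.1) (lift x.2 a) (lift x.2 a').
  have := pairing_dual_word (bs x.1) (lift x.2 a) (lift x.2 a).
  by rewrite dE => ->; rewrite eqxx; case: eqP.
(* Vertices are the terms of [h], counted with multiplicity; an edge starts at its term and is
   reversed by the cancellation of its face. *)
pose G := @Multigraph _ _ fst r rK rneq.
pose alpha (e : edge G) : 'rV[int]_m.+1 := val (s e.1 e.2).
pose es (p : vertex G) : {ffun 'I_m.+1 -> edge G} := [ffun i => (p, i)].
have inj_es p : injective (es p) by move=> i i'; rewrite !ffunE => -[].
have esP p : perm_eq (codom (es p)) (enum (edges_at p)).
  apply: uniq_perm; rewrite ?enum_uniq //; first exact/injectiveP.
  move=> [q i]; rewrite mem_enum inE /=.
  apply/codomP/eqP => [[i']|->]; first by rewrite ffunE => -[].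
  by exists i; rewrite ffunE.
have transition (e : edge G) : exists (w : 'S_m) k,
   [/\ forall a, val (s (r e).1 a) = (a != (r e).2)%:R *:
         val (s e.1 (lift_perm (r e).2 e.2 w a)) + k a *: val (s e.1 e.2),
       b (r e).1 (+) odd (r e).2 (+) w = ~~ (b e.1 (+) odd e.2),
       k (r e).2 = 1 \/ k (r e).2 = -1 &
       alpha (r e) = k (r e).2 *: alpha e].
  (* Both determinants are [1] or [-1], which forces the coefficient at the reversed edge to be a
     sign. *)
  have [w [/face_transition[k kE] sgE]] := rP e; exists w, k; split=> //.
    have := det_face_transition kE.
    rewrite -![(-1) ^+ nat_of_ord _]signr_odd -!signr_addb.
    move: (_ (+) _) (k _) => [] z; rewrite ?expr0 ?expr1;
    case: (det_basis_word (bs (r e).1)) => ->; case: (det_basis_word (bs e.1)) => ->;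
    by lia.
  by rewrite /alpha kE eqxx scale0r add0r.
have reg : regular G m.+1.
  by move=> p; rewrite cardE -(perm_size (esP p)) size_codom card_ord.
have ax : axial_axioms alpha.
  split=> [e|p|e].
  - have [w [k [_ _ [k1|k1] ->]]] := transition e; rewrite k1 ?scale1r ?scaleN1r; auto.
  - apply/(enumeration_basis alpha (esP p)).
    by apply: (Zbasis_bij (f := id)) (bs p) => [|i]; [exists id|rewrite ffunE].
  have [w [k [kE _ _ _]]] := transition e.
  have cg a : exists x : int, alpha ((r e).1, a) -
      alpha (e.1, lift_perm (r e).2 e.2 w a) = x *: alpha e.
    (* At the reversed edge the matched vector is [alpha e] itself, hence the correction by one. *)
    exists (k a - (a == (r e).2)%:R); rewrite /alpha /= kE.
    have [->|_] := eqVneq a (r e).2.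
      by rewrite lift_perm_id scale0r add0r scalerBl scale1r.
    by rewrite scale1r subr0 addrC addKr.
  split=> [[q a]|[p a]]; rewrite inE => /eqP /= ->.
    by exists (e.1, lift_perm (r e).2 e.2 w a); [rewrite inE|apply: cg].
  exists ((r e).1, ((lift_perm (r e).2 e.2 w)^-1)%g a); first by rewrite inE.
  by have := cg ((lift_perm (r e).2 e.2 w)^-1%g a); rewrite permKV.
pose TG := TorusGraph reg ax.
(* Chosen so that [sigma p] times the determinant is the sign of the term [p] in [h]. *)
pose sigma (p : vertex TG) : int := (-1) ^+ b p * \det (word_mx (s p)).
have sigma1 p : sigma p = 1 \/ sigma p = -1.
  by rewrite /sigma; case: (det_basis_word (bs p)) => ->; case: (b p); auto.
exists TG, sigma; split; first split=> // e.
  have [w [k [kE sgE k1 kc]]] := transition e.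
  rewrite -[axial (reverse e)]/(alpha (r e)) kc -[axial e]/(alpha e).
  rewrite scalerA -scaleNr; congr (_ *: _); rewrite /sigma /=.
  rewrite (det_face_transition kE) -![(-1) ^+ nat_of_ord _]signr_odd.
  (* The rule [sgE] for opposite faces, solved for the sign of the initial term. *)
  have -> : (-1) ^+ b e.1 =
      - ((-1) ^+ b (r e).1 * (-1) ^+ odd (r e).2 * (-1) ^+ w * (-1) ^+ odd e.2) :> int.
    by rewrite -!signr_addb sgE; case: (b e.1); case: (odd _).
  move: (\det _) ((-1) ^+ b _) ((-1) ^+ odd (r e).2) ((-1) ^+ w) ((-1) ^+ odd e.2).
  by case: k1 => -> {}*; ring.
apply: eq_bigr => p _.
rewrite (vertex_monomialE (esP p : enumerates (G := TG) p (es p)) (sigma1 p)).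
have aE : axial_word (G := TG) (es p) = s p.
  by apply/ffunP=> i; apply/val_inj; rewrite !ffunE.
rewrite axial_detE /axial_wedge -/(axial_word _) aE /sigma; congr (_ *~ _).
by case: (det_basis_word (bs p)) => ->; ring.
Qed.

Theorem theorem2p25 (n : nat) (hn : (0 < n)%N) (h : ext n (J n))
  (hfaithful : faithful h) :
  (exists (G : torus_graph n) (sigma : vertex G -> int),
      is_orientation sigma /\ h = torus_polynomial sigma) <->
  boundary (dual h) = 0%R.
Proof.
case: n hn h hfaithful => [//|m] _ h fh; split; last exact: torus_graph_of_boundary0.
by case=> G [sigma [os ->]]; apply: boundary_dual_torus_polynomial.
Qed.
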